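(* Let $(\mathbb{S},\to)$ be a topological timed transition system. Then: (1) $\mathrm{E}_f$ is monotonic ($I_0\subseteq I_1\implies \mathrm{E}_f(I_0)\subseteq\mathrm{E}_f(I_1)$) and preserves arbitrary unions: $\mathrm{E}_f(\bigcup K)=\bigcup\{\mathrm{E}_f(I)\mid I\in K\}$ for every $K\subseteq\mathsf{P}(\mathbb{S})$. (2) $\mathrm{R}_f$ is monotonic, preserves arbitrary unions, is a closure operator, i.e. $I\subseteq\mathrm{R}_f(I)=\mathrm{R}_f(\mathrm{R}_f(I))$, and $\pi(\mathrm{E}_f(I))=\mathrm{R}_f(I)$ for all $I\subseteq\mathbb{S}$. (3) If $\mathcal{H}$ is a hybrid system on a Banach space $\mathbb{S}$, then for all $I\subseteq\mathbb{S}$, $\mathrm{E}_f^{\mathcal{H}}(I)=\mathrm{R}_f^{t(\mathcal{H})}(\{0\}\times I)$, and for all $J\subseteq\mathbb{R}\times\mathbb{S}$, $\pi(\mathrm{R}_f^{t(\mathcal{H})}(J))=\mathrm{R}_f^{\mathcal{H}}(\pi(J))$. Here $\pi:\mathbb{R}\times\mathbb{S}\to\mathbb{S}$ is $\pi(t,s)=s$ and $\pi(J)$ denotes the image.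
   Context: Let $\mathbb{T}=\{d\in\mathbb{R}\mid d\geq 0\}$. A topological timed transition system (TTTS) is a pair $(\mathbb{S},\to)$ with $\mathbb{S}$ a topological space and a relation $\to\subseteq\mathbb{S}\times\mathbb{T}\times\mathbb{S}$, written $s\xrightarrow{d}s'$; its transition relation is $s\to s'$ iff $\exists d.\,s\xrightarrow{d}s'$. The evolution map $\mathrm{E}_f:\mathsf{P}(\mathbb{S})\to\mathsf{P}(\mathbb{T}\times\mathbb{S})$ sends $I$ to the smallest $S\subseteq\mathbb{T}\times\mathbb{S}$ with $\{0\}\times I\subseteq S$ and such that $(t,s)\in S$ and $s\xrightarrow{d}s'$ imply $(t+d,s')\in S$. The reachability map $\mathrm{R}_f:\mathsf{P}(\mathbb{S})\to\mathsf{P}(\mathbb{S})$ sends $I$ to the smallest $S\subseteq\mathbb{S}$ with $I\subseteq S$ and such that $s\in S$, $s\to s'$ imply $s'\in S$. A hybrid system (HS) on a Banach space $\mathbb{S}$ is a pair $\mathcal{H}=(F,G)$ with $F,G\subseteq\mathbb{S}\times\mathbb{S}$; it induces the TTTS $(\mathbb{S},\to_{\mathcal{H}})$ where $s\xrightarrow{d}_{\mathcal{H}}s'$ iff either $d=0$ and $(s,s')\in G$, or $d>0$ and there is a continuous $f:[0,d]\to\mathbb{S}$ with derivative $\dot f$ defined and continuous on $(0,d)$, $f(0)=s$, $f(d)=s'$, and $(f(t),\dot f(t))\in F$ for all $t\in(0,d)$. $\mathrm{E}_f^{\mathcal{H}},\mathrm{R}_f^{\mathcal{H}}$ denote the maps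 for this induced TTTS. The clocked system $t(\mathcal{H})=(F',G')$ on $\mathbb{R}\times\mathbb{S}$ has $F'=\{((t,s),(1,\dot s))\mid(s,\dot s)\in F\}$, $G'=\{((t,s),(t,s^+))\mid(s,s^+)\in G\}$. *)

(* Defs.v *)
From HB Require Import structures.
From mathcomp Require Import all_boot all_order all_algebra.
From mathcomp Require Import all_classical all_reals all_analysis.

Set Implicit Arguments.
Unset Strict Implicit.
Unset Printing Implicit Defensive.

Import Order.TTheory GRing.Theory Num.Theory.
Import numFieldNormedType.Exports.

Local Open Scope classical_set_scope.
Local Open Scope ring_scope.

(* [HB.saturate] declares the joins missing for products, such as pointed
   uniform spaces; completeness of a product is missing as well.  Together they
   make [R * S] a Banach space (for the max norm) when [S] is one. *)
HB.saturate prod.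

Lemma prod_complete (U V : completeType) (F : set_system (U * V)) :
  ProperFilter F -> cauchy F -> cvg F.
Proof.
move=> FF Fc.
have c1 : cauchy (fst @ F).
  move=> A entA.
  have : entourage [set xy : (U * V) * (U * V) | A (xy.1.1, xy.2.1)].
    exists (A, setT); first by split => //; exact: filterT.
    move=> [[a b] [c d]] /= [aA _]; by exists ((a, c), (b, d)).
  move=> /Fc [] [P Q] /= [FP FQ] PQ.
  exists (fst @` P, fst @` Q) => /=.
    by split; [apply: filterS FP|apply: filterS FQ] => x Px /=; exists x.
  by move=> [_ _] /= [[x Px <-] [y Qy <-]]; exact: (PQ (x, y)).
have c2 : cauchy (snd @ F).
  move=> A entA.
  have : entourage [set xy : (U * V) * (U * V) | A (xy.1.2, xy.2.2)].
    exists (setT, A); first by split => //; exact: filterT.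
    move=> [[a b] [c d]] /= [_ bA]; by exists ((a, c), (b, d)).
  move=> /Fc [] [P Q] /= [FP FQ] PQ.
  exists (snd @` P, snd @` Q) => /=.
    by split; [apply: filterS FP|apply: filterS FQ] => x Px /=; exists x.
  by move=> [_ _] /= [[x Px <-] [y Qy <-]]; exact: (PQ (x, y)).
have Fl := cauchy_cvg _ c1.
have Fm := cauchy_cvg _ c2.
apply/cvg_ex; exists (lim (fst @ F), lim (snd @ F)) => A [[P Q] /= [lP mQ] PQA].
have FPQ : F ((fst @^-1` P) `&` (snd @^-1` Q)).
  by apply: filterI; [exact: Fl|exact: Fm].
by apply: (filterS _ FPQ) => x [Px Qx]; exact: PQA.
Qed.

HB.instance Definition _ (K : numFieldType) (U V : completeNormedModType K) :=
  Uniform_isComplete.Build (U * V)%type (@prod_complete U V).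

Definition ttts (R : realType) (S : topologicalType) :=
  S -> {nonneg R} -> S -> Prop.

Section Ttts.
Context {R : realType} {S : topologicalType}.
Implicit Types (T : ttts R S) (I : set S).

Definition step T : S -> S -> Prop := fun s s' => exists d, T s d s'.

Definition evolution T I : set ({nonneg R} * S) :=
  smallest
    (fun A => forall (t d : {nonneg R}) s s',
       A (t, s) -> T s d s' -> A ((t%:num + d%:num)%:nng, s'))
    ([set 0%:nng] `*` I).

Definition reach T I : set S :=
  smallest (fun A => forall s s', A s -> step T s s' -> A s') I.

End Ttts.

Record hybrid_system (R : realType) (S : completeNormedModType R) :=
  HybridSystem { flow : set (S * S) ; jump : set (S * S) }.

Section Hybrid.
Context {R : realType} {S : completeNormedModType R}.

(* [f] is total, but only its restriction to [0, d] matters: the derivatives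
   are taken at interior points. *)
Definition flows (F : set (S * S)) (d : R) (s s' : S) : Prop :=
  exists f : R -> S,
    [/\ {within `[0, d], continuous f},
        (forall t, t \in `]0, d[ -> derivable f t 1),
        {within `]0, d[, continuous (derive1 f)},
        f 0 = s /\ f d = s' &
        forall t, t \in `]0, d[ -> F (f t, derive1 f t)].

Definition hybrid_ttts (H : hybrid_system S) : ttts R S :=
  fun s d s' =>
    (d%:num = 0 /\ jump H (s, s')) \/ (0 < d%:num /\ flows (flow H) d%:num s s').

Definition clocked (H : hybrid_system S) : hybrid_system (R * S)%type :=
  HybridSystem
    [set ((t, x.1), (1, x.2)) | t in [set: R] & x in flow H]
    [set ((t, x.1), (t, x.2)) | t in [set: R] & x in jump H].

End Hybrid.

(* Main.v *)
(* [evolution] and [reach] are both closures of a set under a binary relation.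
   Such closures are monotone, idempotent and preserve unions, and they commute
   with taking images along any map whose graph is a bisimulation.  The three
   remaining identities are instances of this: the projection forgetting time,
   the embedding of [{nonneg R} * S] into [R * S], and the projection of the
   clocked system onto the original one.  That the last two are bisimulations
   amounts to the fact that a flow of the clocked system is exactly
   [u |-> (t + u, f u)] with [f] a flow of the original system, the first
   component being determined at the endpoint by the mean value theorem. *)
Require Import Defs.
From HB Require Import structures.
From mathcomp Require Import all_boot all_order all_algebra.
From mathcomp Require Import all_classical all_reals all_analysis.

Import Order.TTheory GRing.Theory Num.Theory.
Import numFieldNormedType.Exports.

Local Open Scope classical_set_scope.
Local Open Scope ring_scope.

(** [reach T] unfolds to [rel_closure (step T)], so the lemmas on closures apply to it by
    conversion; [evolution] first goes through [evolutionE]. *)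
Definition rel_closure {X : Type} (r : X -> X -> Prop) : set X -> set X :=
  smallest (fun A => forall x y, A x -> r x y -> A y).

Section RelClosure.
Context {X : Type} (r : X -> X -> Prop).
Implicit Types I J : set X.

Lemma rel_closure_step I x y :
  rel_closure r I x -> r x y -> rel_closure r I y.
Proof. by move=> Ix rxy A AP; exact: (AP.1 x) (Ix A AP) rxy. Qed.

Lemma le_rel_closure I J : I `<=` J -> rel_closure r I `<=` rel_closure r J.
Proof. by move=> IJ x Ix A [Ar JA]; apply: Ix; split=> // y /IJ/JA. Qed.

Lemma rel_closure_id I : rel_closure r (rel_closure r I) = rel_closure r I.
Proof.
apply/seteqP; split; last exact: sub_gen_smallest.
by apply: smallest_sub => // x y; exact: rel_closure_step.
Qed.

(** A step has a single premise, so a union of sets closed under [r] is again closed under [r]. *)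
Lemma rel_closure_bigcup (K : set (set X)) :
  rel_closure r (\bigcup_(I in K) I) = \bigcup_(I in K) rel_closure r I.
Proof.
apply/seteqP; split.
- apply: smallest_sub => [x y [I KI Ix] rxy|x [I KI Ix]].
    by exists I => //; exact: rel_closure_step rxy.
  by exists I => //; exact: sub_gen_smallest Ix.
- by move=> x [I KI]; apply: le_rel_closure => y Iy; exists I.
Qed.

End RelClosure.

(* The hypotheses say that the graph of [f] is a bisimulation. *)
Lemma image_rel_closure {X Y : Type} {r : X -> X -> Prop} {q : Y -> Y -> Prop}
    (f : X -> Y) (I : set X) :
  (forall x x', r x x' -> q (f x) (f x')) ->
  (forall x y, q (f x) y -> exists2 x', r x x' & f x' = y) ->
  f @` rel_closure r I = rel_closure q (f @` I).
Proof.
move=> rq qr; apply/seteqP; split.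
- rewrite image_sub; apply: smallest_sub => [y z fy /rq|y Iy].
    exact: rel_closure_step fy.
  by apply: sub_gen_smallest; exists y.
- apply: smallest_sub => [_ y [x Ix <-] /qr[x' rxx' <-]|_ [x Ix <-]].
    by exists x' => //; exact: rel_closure_step rxx'.
  by exists x => //; exact: sub_gen_smallest Ix.
Qed.

Section TttsClosure.
Context {R : realType} {S : topologicalType} (T : ttts R S).

Definition timed_step (x y : {nonneg R} * S) : Prop :=
  exists2 d : {nonneg R}, T x.2 d y.2 & y.1 = (x.1%:num + d%:num)%:nng.

Lemma evolutionE I :
  evolution T I = rel_closure timed_step ([set 0%:nng] `*` I).
Proof.
congr (smallest _ _); apply/funext => A; apply/propext; split.
- by move=> Astep [t s] [t' s'] At [d /= sds' ->]; exact: Astep sds'.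
- by move=> Astep t d s s' At sds'; apply: Astep At _; exists d.
Qed.

(** Elapsed time never restricts a transition, so a step from [s] lifts to a timed step from every
    [(t, s)]. *)
Lemma image_snd_evolution I : snd @` evolution T I = reach T I.
Proof.
rewrite evolutionE (@image_rel_closure _ _ _ (step T)).
- congr (rel_closure _ _); apply/seteqP.
  by split=> [_ [[t s] [_ Is] <-]//|s Is]; exists (0%:nng, s).
- by move=> x y [d sds' _]; exists d.
- by move=> [t s] s' [d sds']; exists ((t%:num + d%:num)%:nng, s') => //; exists d.
Qed.

End TttsClosure.

Section PairDerivative.
Context {R : realType} {U V : normedModType R}.

(** Dropping the direction [1] leaves a plain limit of difference quotients, so pairing and
    projecting derivatives reduces to pairing and projecting limits. *)
Lemma is_deriveP {W : normedModType R} (f : R -> W) (a : R) (l : W) :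
  is_derive a 1 f l <-> h^-1 *: (f (h + a) - f a) @[h --> 0^'] --> l.
Proof.
have -> : (fun h => h^-1 *: (f (h + a) - f a)) =
          (fun h => h^-1 *: ((f \o shift a) (h *: 1) - f a)).
  by apply/funext => h /=; rewrite [h *: 1]mulr1.
split=> [[df <-]//|fl].
by apply: DeriveDef; [apply/cvg_ex; exists l|exact: cvg_lim].
Qed.

Lemma is_derive_pair (f : R -> U) (g : R -> V) (a : R) df dg :
  is_derive a 1 f df -> is_derive a 1 g dg ->
  is_derive a 1 (fun t => (f t, g t)) (df, dg).
Proof.
move=> /is_deriveP fd /is_deriveP gd; apply/is_deriveP.
exact: (cvg_pair fd gd).
Qed.

Lemma is_derive_fst (f : R -> U * V) (a : R) df :
  is_derive a 1 f df -> is_derive a 1 (fst \o f) df.1.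
Proof. by move=> /is_deriveP fd; apply/is_deriveP; exact: cvg_comp fd cvg_fst. Qed.

Lemma is_derive_snd (f : R -> U * V) (a : R) df :
  is_derive a 1 f df -> is_derive a 1 (snd \o f) df.2.
Proof. by move=> /is_deriveP fd; apply/is_deriveP; exact: cvg_comp fd cvg_snd. Qed.

End PairDerivative.

Section WithinContinuous.
Context {T U V : topologicalType} {A : set T}.

Lemma within_continuous_pair (f : T -> U) (g : T -> V) :
  {within A, continuous f} -> {within A, continuous g} ->
  {within A, continuous (fun x => (f x, g x))}.
Proof. by move=> cf cg x; exact: cvg_pair (cf x) (cg x). Qed.

Lemma continuous_within_comp (f : T -> U) (g : U -> V) :
  continuous g -> {within A, continuous f} -> {within A, continuous (g \o f)}.
Proof. by move=> cg cf x; exact: cvg_comp (cf x) (cg (f x)). Qed.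

End WithinContinuous.

Section ClockedFlow.
Context {R : realType} {S : completeNormedModType R}.

Lemma flows_clocked (H : hybrid_system S) (d t : R) (s s' : S) :
  flows (flow H) d s s' ->
  flows (flow (clocked H)) d (t, s) (t + d, s').
Proof.
move=> [f [cf df cdf [f0 fd] Ff]].
pose g u := (t + u, f u).
have dg u : u \in `]0, d[ -> is_derive u 1 g (1, derive1 f u).
  move=> ud; apply: is_derive_pair; first by apply: is_derive_eq; rewrite add0r.
  by rewrite derive1E; apply: derivableP; exact: df.
have dgE u : u \in `]0, d[ -> derive1 g u = (1, derive1 f u).
  by move=> /dg gu; rewrite derive1E derive_val.
have cg : {within `[0, d], continuous g}.
  apply: within_continuous_pair cf.
  by apply: continuous_subspaceT => u; apply: cvgD; [exact: cvg_cst|exact: cvg_id].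
(* The formula for [derive1 g] is known only on the open interval, hence the transfer of continuity
   along equality on that subspace. *)
have cdg : {within `]0, d[, continuous (derive1 g)}.
  apply: (@subspace_eq_continuous _ _ _ (fun u => (1 : R, derive1 f u))).
    by move=> u /[!inE] ud; rewrite /from_subspace dgE.
  by apply: within_continuous_pair cdf; apply: continuous_subspaceT;
    exact: cst_continuous.
exists g; split.
- exact: cg.
- by move=> u /dg [].
- exact: cdg.
- by rewrite /g f0 fd addr0.
- move=> u ud; have -> : derive1 g u = (1, derive1 f u) by exact: dgE.
  by exists (t + u) => //; exists (f u, derive1 f u) => //; exact: Ff.
Qed.

Lemma flows_clockedE (H : hybrid_system S) (d : R) (x y : R * S) : 0 < d ->
  flows (flow (clocked H)) d x y ->
  y.1 = x.1 + d /\ flows (flow H) d x.2 y.2.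
Proof.
move=> d0 [g [cg dg cdg [<- <-] Fg]].
have cfst : continuous (@fst R S) by move=> ?; exact: cvg_fst.
have csnd : continuous (@snd R S) by move=> ?; exact: cvg_snd.
have gD u : u \in `]0, d[ -> is_derive u 1 g (derive1 g u).
  by move=> /dg/derivableP; rewrite derive1E.
have g1 u : u \in `]0, d[ -> (derive1 g u).1 = 1.
  by move=> /Fg [v _ [w _ [_ <-]]].
have dsnd u : u \in `]0, d[ -> derive1 (snd \o g) u = (derive1 g u).2.
  by move=> /gD /is_derive_snd ?; rewrite derive1E derive_val.
split.
(* The clock has derivative constantly [1], so the intermediate point [c] is irrelevant and the
   increment over [[0, d]] is exactly [d]. *)
- have [||c _ /=] := @MVT R (fst \o g) (cst 1) 0 d d0.
  + by move=> u ud; have := is_derive_fst _ _ _ (gD u ud); rewrite g1.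
  + exact: continuous_within_comp cfst cg.
  + by rewrite subr0 mul1r => /eqP; rewrite subr_eq addrC => /eqP.
- exists (snd \o g); split => //.
  + exact: continuous_within_comp csnd cg.
  + by move=> u /gD /is_derive_snd [].
  + apply: (@subspace_eq_continuous _ _ _ (snd \o derive1 g)).
      by move=> u /[!inE] ud; rewrite /from_subspace dsnd.
    exact: continuous_within_comp csnd cdg.
  + move=> u ud; rewrite dsnd//=; have [v _ [w Fw /=]] := Fg _ ud.
    case: (g u) (derive1 g u) => a b [a' b'] [_ <- _ <-].
    by rewrite -surjective_pairing.
Qed.

(** A jump has duration [0] and leaves the clock unchanged, so one equation [y.1 = x.1 + d] covers
    both jumps and flows. Both bisimulations below are read off from this form. *)
Lemma step_clocked (H : hybrid_system S) (x y : R * S) :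
  step (hybrid_ttts (clocked H)) x y <->
  exists2 d : {nonneg R}, hybrid_ttts H x.2 d y.2 & y.1 = x.1 + d%:num.
Proof.
case: x y => t s [t' s']; split=> /= -[d].
- move=> [[d0 [u _ [v Hv] [-> <- <- <-]]]|[d0 /flows_clockedE[]//= -> fl]].
    by exists d; [left; rewrite -surjective_pairing|rewrite d0 addr0].
  by exists d => //; right.
- move=> [[d0 Gs]|[d0 fl]] ->; exists d.
    by left; split=> //; rewrite d0 addr0; exists t => //; exists (s, s').
  by right; split=> //; exact: flows_clocked.
Qed.

(** Durations are nonnegative, so a clocked step from a nonnegative clock value ends at one, and its
    target stays in the image of the embedding. *)
Lemma evolution_clocked (H : hybrid_system S) (I : set S) :
  [set (ts.1%:num, ts.2) | ts in evolution (hybrid_ttts H) I] =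
  reach (hybrid_ttts (clocked H)) ([set 0] `*` I).
Proof.
rewrite evolutionE (@image_rel_closure _ _ _ (step (hybrid_ttts (clocked H)))).
- congr (rel_closure _ _); apply/seteqP; split.
    by move=> _ [[_ s] [/= -> Is] <-].
  by move=> [_ s] [/= -> Is]; exists (0%:nng, s).
- by move=> x y [d xy ydx]; apply/step_clocked; exists d => //=; rewrite ydx.
- move=> [t s] [t' s'] /step_clocked[d /= sds' ->].
  by exists ((t%:num + d%:num)%:nng, s') => //; exists d.
Qed.

(** The dynamics do not depend on the clock, so a step of [H] lifts to a clocked step from any clock
    value. *)
Lemma image_snd_reach_clocked (H : hybrid_system S) (J : set (R * S)) :
  snd @` reach (hybrid_ttts (clocked H)) J = reach (hybrid_ttts H) (snd @` J).
Proof.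
apply: image_rel_closure => [x y /step_clocked[d]|x s' [d sds']]; first by exists d.
by exists (x.1 + d%:num, s') => //; apply/step_clocked; exists d.
Qed.

End ClockedFlow.

Theorem theorem1 (R : realType) :
  (forall (S : topologicalType) (T : ttts R S),
     ((forall I0 I1 : set S,
         I0 `<=` I1 -> evolution T I0 `<=` evolution T I1) /\
      (forall K : set (set S),
         evolution T (\bigcup_(I in K) I) = \bigcup_(I in K) evolution T I)) /\
     [/\ forall I0 I1 : set S, I0 `<=` I1 -> reach T I0 `<=` reach T I1,
         forall K : set (set S),
           reach T (\bigcup_(I in K) I) = \bigcup_(I in K) reach T I,
         forall I : set S, I `<=` reach T I /\ reach T I = reach T (reach T I) &
         forall I : set S, snd @` evolution T I = reach T I]) /\
  (forall (S : completeNormedModType R) (H : hybrid_system S),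
     (forall I : set S,
        [set (ts.1%:num, ts.2) | ts in evolution (hybrid_ttts H) I] =
        reach (hybrid_ttts (clocked H)) ([set 0] `*` I)) /\
     (forall J : set (R * S),
        snd @` reach (hybrid_ttts (clocked H)) J =
        reach (hybrid_ttts H) (snd @` J))).
Proof.
split=> S T; last first.
  by split; [exact: evolution_clocked|exact: image_snd_reach_clocked].
split; first split.
- move=> I J IJ; rewrite !evolutionE; apply: le_rel_closure => x [? Ix].
  by split=> //; exact: IJ.
- move=> K; rewrite evolutionE.
  (* The initial set is rewritten as the union of a family of sets, the shape that
     [rel_closure_bigcup] expects. *)
  have -> : [set (0%:nng : {nonneg R})] `*` \bigcup_(I in K) I =
            \bigcup_(J in [set [set 0%:nng] `*` I | I in K]) J.
    by rewrite bigcup_image setX_bigcupr.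
  rewrite rel_closure_bigcup bigcup_image.
  by apply: eq_bigcupr => I _; rewrite evolutionE.
split.
- exact: le_rel_closure.
- exact: rel_closure_bigcup.
- by move=> I; split; [exact: sub_gen_smallest|exact/esym/rel_closure_id].
- exact: image_snd_evolution.
Qed.
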